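(* Every nonzero bicomplex number $\omega$ can be written in the form $$\omega=|\omega|_{\mathbf{j}}\,(\cos\phi+\mathbf{i}\sin\phi),$$ where $\phi\in\mathbb{D}$ is a hyperbolic number (called a $\mathbb{D}$-argument of $\omega$).
   Context: $\mathbb{D}=\{x+\mathbf{j}y:x,y\in\mathbb{R}\}$, $\mathbf{j}^2=1$, $\mathbf{j}\notin\mathbb{R}$, is the algebra of hyperbolic numbers; with $\mathbf{e}_1=\frac{1+\mathbf{j}}{2}$, $\mathbf{e}_2=\frac{1-\mathbf{j}}{2}$, each $z=x+\mathbf{j}y$ is $\pi_1(z)\mathbf{e}_1+\pi_2(z)\mathbf{e}_2$, where $\pi_1(z)=x+y$, $\pi_2(z)=x-y$. For $z\in\mathbb{D}$, $\cos z$ and $\sin z$ are given by the usual power series; equivalently $\cos z=\cos(\pi_1(z))\mathbf{e}_1+\cos(\pi_2(z))\mathbf{e}_2$ and $\sin z=\sin(\pi_1(z))\mathbf{e}_1+\sin(\pi_2(z))\mathbf{e}_2$. $\mathbb{B}=\mathbb{D}+\mathbf{i}\mathbb{D}$ is the commutative real algebra of bicomplex numbers $a+b\mathbf{i}+c\mathbf{j}+d\mathbf{k}$ ($a,b,c,d\in\mathbb{R}$), with $\mathbf{i}^2=\mathbf{k}^2=-1$, $\mathbf{j}^2=1$, $\mathbf{i}\mathbf{k}=\mathbf{k}\mathbf{i}=\mathbf{j}$. Each $\omega\in\mathbb{B}$ is uniquely $\mathrm{Re}_{\mathbf{j}}(\omega)+\mathbf{i}\,\mathrm{Im}_{\mathbf{j}}(\omega)$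 with $\mathrm{Re}_{\mathbf{j}}(\omega),\mathrm{Im}_{\mathbf{j}}(\omega)\in\mathbb{D}$, and $|\omega|_{\mathbf{j}}=\sqrt{\mathrm{Re}_{\mathbf{j}}(\omega)^2+\mathrm{Im}_{\mathbf{j}}(\omega)^2}\in\mathbb{D}$ (nonnegative square root taken componentwise in $\mathbf{e}_1,\mathbf{e}_2$). *)

(* Defs.v *)
From HB Require Import structures.
From mathcomp Require Import all_boot all_order all_algebra.
From mathcomp Require Import ring lra.
From mathcomp Require Import all_classical all_reals all_analysis.

Set Implicit Arguments.
Unset Strict Implicit.
Unset Printing Implicit Defensive.

Import Order.TTheory GRing.Theory Num.Theory.
Import numFieldNormedType.Exports.

Local Open Scope ring_scope.

(* [Hyperbolic x y] is x + j y. *)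
Record hyperbolic (R : realType) := Hyperbolic { hre : R; him : R }.

Section HyperbolicAlgebra.
Variable R : realType.
Implicit Types z : hyperbolic R.

Definition hyp_pair z : R * R := (hre z, him z).
Definition pair_hyp (p : R * R) : hyperbolic R := Hyperbolic p.1 p.2.
Lemma hyp_pairK : cancel hyp_pair pair_hyp. Proof. by case. Qed.
HB.instance Definition _ :=
  Choice.copy (hyperbolic R) (can_type hyp_pairK).

Definition hyp_zero := @Hyperbolic R 0 0.
Definition hyp_opp z := Hyperbolic (- hre z) (- him z).
Definition hyp_add z1 z2 := Hyperbolic (hre z1 + hre z2) (him z1 + him z2).

Lemma hyp_addA : associative hyp_add.
Proof. by move=> [a b] [c d] [e f]; rewrite /hyp_add /= !addrA. Qed.
Lemma hyp_addC : commutative hyp_add.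
Proof. by move=> [a b] [c d]; congr Hyperbolic; rewrite addrC. Qed.
Lemma hyp_add0 : left_id hyp_zero hyp_add.
Proof. by move=> [a b]; rewrite /hyp_add /= !add0r. Qed.
Lemma hyp_addN : left_inverse hyp_zero hyp_opp hyp_add.
Proof. by move=> [a b]; rewrite /hyp_add /= !addNr. Qed.
HB.instance Definition _ := GRing.isZmodule.Build (hyperbolic R)
  hyp_addA hyp_addC hyp_add0 hyp_addN.

Definition hyp_one := @Hyperbolic R 1 0.
Definition hyp_mul z1 z2 :=
  Hyperbolic (hre z1 * hre z2 + him z1 * him z2)
             (hre z1 * him z2 + him z1 * hre z2).

Lemma hyp_mulA : associative hyp_mul.
Proof. by move=> [a b] [c d] [e f]; congr Hyperbolic => /=; ring. Qed.
Lemma hyp_mulC : commutative hyp_mul.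
Proof. by move=> [a b] [c d]; congr Hyperbolic => /=; ring. Qed.
Lemma hyp_mul1 : left_id hyp_one hyp_mul.
Proof. by move=> [a b]; congr Hyperbolic => /=; ring. Qed.
Lemma hyp_mulDl : left_distributive hyp_mul +%R.
Proof. by move=> [a b] [c d] [e f]; congr Hyperbolic => /=; ring. Qed.
Lemma hyp_one_neq0 : hyp_one != 0.
Proof. by apply/eqP => -[/eqP]; rewrite oner_eq0. Qed.
HB.instance Definition _ := GRing.Zmodule_isComNzRing.Build (hyperbolic R)
  hyp_mulA hyp_mulC hyp_mul1 hyp_mulDl hyp_one_neq0.

Definition hyp_scale (a : R) z := Hyperbolic (a * hre z) (a * him z).

Lemma hyp_scaleA a b z : hyp_scale a (hyp_scale b z) = hyp_scale (a * b) z.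
Proof. by rewrite /hyp_scale /= !mulrA. Qed.
Lemma hyp_scale1 : left_id 1 hyp_scale.
Proof. by move=> [a b]; rewrite /hyp_scale /= !mul1r. Qed.
Lemma hyp_scaleDr : right_distributive hyp_scale +%R.
Proof. by move=> a z1 z2; rewrite /hyp_scale /= !mulrDr. Qed.
Lemma hyp_scaleDl z : {morph hyp_scale^~ z : a b / a + b}.
Proof. by move=> a b; rewrite /hyp_scale /= !mulrDl. Qed.
HB.instance Definition _ := GRing.Zmodule_isLmodule.Build R (hyperbolic R)
  hyp_scaleA hyp_scale1 hyp_scaleDr hyp_scaleDl.

Lemma hyp_scaleAl (a : R) z1 z2 : a *: (z1 * z2) = (a *: z1) * z2.
Proof. by case: z1 z2 => [b c] [d e]; congr Hyperbolic => /=; ring. Qed.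
HB.instance Definition _ :=
  GRing.Lmodule_isLalgebra.Build R (hyperbolic R) hyp_scaleAl.
HB.instance Definition _ := GRing.Lalgebra_isComAlgebra.Build R (hyperbolic R).

End HyperbolicAlgebra.

Section Hyperbolic.
Variable R : realType.
Implicit Types z : hyperbolic R.

Definition hj : hyperbolic R := Hyperbolic 0 1.
Definition he1 : hyperbolic R := 2^-1 *: (1 + hj).
Definition he2 : hyperbolic R := 2^-1 *: (1 - hj).
Definition hpi1 z : R := hre z + him z.
Definition hpi2 z : R := hre z - him z.

(* Intended for z with both idempotent components nonnegative: [Num.sqrt]
   sends negative reals to 0. *)
Definition hsqrt z : hyperbolic R :=
  Num.sqrt (hpi1 z) *: he1 + Num.sqrt (hpi2 z) *: he2.

(* The limit of a sequence of hyperbolic numbers, for the usual topology of the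
   real plane. *)
Definition hlim (u : nat -> hyperbolic R) : hyperbolic R :=
  Hyperbolic (limn (fun n => hre (u n))) (limn (fun n => him (u n))).

Definition hcos z : hyperbolic R :=
  hlim (fun n => \sum_(0 <= k < n) ((-1) ^+ k / (k.*2)`!%:R) *: z ^+ k.*2).

Definition hsin z : hyperbolic R :=
  hlim (fun n =>
    \sum_(0 <= k < n) ((-1) ^+ k / (k.*2.+1)`!%:R) *: z ^+ k.*2.+1).

Lemma hjj : hj * hj = 1.
Proof. by congr Hyperbolic => /=; ring. Qed.

Lemma hyp_reim z : z = hre z *: 1 + him z *: hj.
Proof. by case: z => a b; congr Hyperbolic => /=; ring. Qed.

Lemma hyp_idem z : z = hpi1 z *: he1 + hpi2 z *: he2.
Proof. by case: z => a b; congr Hyperbolic; rewrite /hpi1 /hpi2 /=; field. Qed.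

Lemma hpi1D : {morph hpi1 : z1 z2 / z1 + z2}.
Proof. by move=> [a b] [c d]; rewrite /hpi1 /=; ring. Qed.
Lemma hpi2D : {morph hpi2 : z1 z2 / z1 + z2}.
Proof. by move=> [a b] [c d]; rewrite /hpi2 /=; ring. Qed.
Lemma hpi1M : {morph hpi1 : z1 z2 / z1 * z2}.
Proof. by move=> [a b] [c d]; rewrite /hpi1 /=; ring. Qed.
Lemma hpi2M : {morph hpi2 : z1 z2 / z1 * z2}.
Proof. by move=> [a b] [c d]; rewrite /hpi2 /=; ring. Qed.
Lemma hpi1Z (a : R) z : hpi1 (a *: z) = a * hpi1 z.
Proof. by case: z => b c; rewrite /hpi1 /=; ring. Qed.
Lemma hpi2Z (a : R) z : hpi2 (a *: z) = a * hpi2 z.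
Proof. by case: z => b c; rewrite /hpi2 /=; ring. Qed.

Lemma hpi1X z n : hpi1 (z ^+ n) = hpi1 z ^+ n.
Proof.
elim: n => [|n IHn]; first by rewrite !expr0 /hpi1 /= addr0.
by rewrite !exprS hpi1M IHn.
Qed.
Lemma hpi2X z n : hpi2 (z ^+ n) = hpi2 z ^+ n.
Proof.
elim: n => [|n IHn]; first by rewrite !expr0 /hpi2 /= subr0.
by rewrite !exprS hpi2M IHn.
Qed.

Lemma hpi1_sum n (F : nat -> hyperbolic R) :
  hpi1 (\sum_(0 <= k < n) F k) = \sum_(0 <= k < n) hpi1 (F k).
Proof. by apply: (big_morph hpi1 hpi1D); rewrite /hpi1 /= addr0. Qed.
Lemma hpi2_sum n (F : nat -> hyperbolic R) :
  hpi2 (\sum_(0 <= k < n) F k) = \sum_(0 <= k < n) hpi2 (F k).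
Proof. by apply: (big_morph hpi2 hpi2D); rewrite /hpi2 /= subr0. Qed.

Local Open Scope classical_set_scope.

Lemma hlim_idem (u : nat -> hyperbolic R) (a b : R) :
  hpi1 (u n) @[n --> \oo] --> a -> hpi2 (u n) @[n --> \oo] --> b ->
  [/\ hre (u n) @[n --> \oo] --> hre (a *: he1 + b *: he2),
      him (u n) @[n --> \oo] --> him (a *: he1 + b *: he2) &
      hlim u = a *: he1 + b *: he2].
Proof.
move=> ua ub.
have cre : hre (u n) @[n --> \oo] --> hre (a *: he1 + b *: he2).
  rewrite (_ : hre (_ + _) = 2^-1 * (a + b)); last by rewrite /=; field.
  rewrite (_ : (fun n => _) = (fun n => 2^-1 * (hpi1 (u n) + hpi2 (u n)))).
    by apply: cvgM; [exact: cvg_cst | exact: cvgD].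
  by apply/funext => n; rewrite /hpi1 /hpi2; field.
have cim : him (u n) @[n --> \oo] --> him (a *: he1 + b *: he2).
  rewrite (_ : him (_ + _) = 2^-1 * (a - b)); last by rewrite /=; field.
  rewrite (_ : (fun n => _) = (fun n => 2^-1 * (hpi1 (u n) - hpi2 (u n)))).
    by apply: cvgM; [exact: cvg_cst | exact: cvgB].
  by apply/funext => n; rewrite /hpi1 /hpi2; field.
split=> //; rewrite /hlim.
by rewrite (cvg_lim (@Rhausdorff R) cre) (cvg_lim (@Rhausdorff R) cim).
Qed.

Lemma hcosE z : hcos z = cos (hpi1 z) *: he1 + cos (hpi2 z) *: he2.
Proof.
suff H (p : hyperbolic R -> R) : (forall (a : R) y, p (a *: y) = a * p y) ->
    (forall y n, p (y ^+ n) = p y ^+ n) ->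
    (forall n (F : nat -> hyperbolic R),
      p (\sum_(0 <= k < n) F k) = \sum_(0 <= k < n) p (F k)) ->
    p (\sum_(0 <= k < n) ((-1) ^+ k / (k.*2)`!%:R) *: z ^+ k.*2)
      @[n --> \oo] --> cos (p z).
  by have [_ _] := hlim_idem (H hpi1 hpi1Z hpi1X hpi1_sum)
                              (H hpi2 hpi2Z hpi2X hpi2_sum).
move=> pZ pX pS; have := @cvg_cos_coeff' R (p z).
apply: cvg_trans; rewrite (_ : (fun n => _) = series (cos_coeff' (p z))) //.
apply/funext => n; rewrite pS /series /=; apply: eq_bigr => k _.
by rewrite pZ pX /cos_coeff' mulrAC.
Qed.

Lemma hsinE z : hsin z = sin (hpi1 z) *: he1 + sin (hpi2 z) *: he2.
Proof.
suff H (p : hyperbolic R -> R) : (forall (a : R) y, p (a *: y) = a * p y) ->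
    (forall y n, p (y ^+ n) = p y ^+ n) ->
    (forall n (F : nat -> hyperbolic R),
      p (\sum_(0 <= k < n) F k) = \sum_(0 <= k < n) p (F k)) ->
    p (\sum_(0 <= k < n) ((-1) ^+ k / (k.*2.+1)`!%:R) *: z ^+ k.*2.+1)
      @[n --> \oo] --> sin (p z).
  by have [_ _] := hlim_idem (H hpi1 hpi1Z hpi1X hpi1_sum)
                              (H hpi2 hpi2Z hpi2X hpi2_sum).
move=> pZ pX pS; have := @cvg_sin_coeff' R (p z).
apply: cvg_trans; rewrite (_ : (fun n => _) = series (sin_coeff' (p z))) //.
apply/funext => n; rewrite pS /series /=; apply: eq_bigr => k _.
by rewrite pZ pX /sin_coeff' mulrAC.
Qed.

End Hyperbolic.

(* [Bicomplex z w] is z + i w, with z and w hyperbolic. *)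
Record bicomplex (R : realType) :=
  Bicomplex { re_j : hyperbolic R; im_j : hyperbolic R }.

Section BicomplexAlgebra.
Variable R : realType.
Implicit Types w : bicomplex R.

Definition bic_pair w : hyperbolic R * hyperbolic R := (re_j w, im_j w).
Definition pair_bic (p : hyperbolic R * hyperbolic R) : bicomplex R :=
  Bicomplex p.1 p.2.
Lemma bic_pairK : cancel bic_pair pair_bic. Proof. by case. Qed.
HB.instance Definition _ :=
  Choice.copy (bicomplex R) (can_type bic_pairK).

Definition bic_zero := @Bicomplex R 0 0.
Definition bic_opp w := Bicomplex (- re_j w) (- im_j w).
Definition bic_add w1 w2 := Bicomplex (re_j w1 + re_j w2) (im_j w1 + im_j w2).

Lemma bic_addA : associative bic_add.
Proof. by move=> [a b] [c d] [e f]; rewrite /bic_add /= !addrA. Qed.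
Lemma bic_addC : commutative bic_add.
Proof. by move=> [a b] [c d]; congr Bicomplex; rewrite addrC. Qed.
Lemma bic_add0 : left_id bic_zero bic_add.
Proof. by move=> [a b]; rewrite /bic_add /= !add0r. Qed.
Lemma bic_addN : left_inverse bic_zero bic_opp bic_add.
Proof. by move=> [a b]; rewrite /bic_add /= !addNr. Qed.
HB.instance Definition _ := GRing.isZmodule.Build (bicomplex R)
  bic_addA bic_addC bic_add0 bic_addN.

Definition bic_one := @Bicomplex R 1 0.
Definition bic_mul w1 w2 :=
  Bicomplex (re_j w1 * re_j w2 - im_j w1 * im_j w2)
            (re_j w1 * im_j w2 + im_j w1 * re_j w2).

Lemma bic_mulA : associative bic_mul.
Proof. by move=> [a b] [c d] [e f]; congr Bicomplex => /=; ring. Qed.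
Lemma bic_mulC : commutative bic_mul.
Proof. by move=> [a b] [c d]; congr Bicomplex => /=; ring. Qed.
Lemma bic_mul1 : left_id bic_one bic_mul.
Proof. by move=> [a b]; congr Bicomplex => /=; ring. Qed.
Lemma bic_mulDl : left_distributive bic_mul +%R.
Proof. by move=> [a b] [c d] [e f]; congr Bicomplex => /=; ring. Qed.
Lemma bic_one_neq0 : bic_one != 0.
Proof. by apply/eqP => -[/eqP]; rewrite oner_eq0. Qed.
HB.instance Definition _ := GRing.Zmodule_isComNzRing.Build (bicomplex R)
  bic_mulA bic_mulC bic_mul1 bic_mulDl bic_one_neq0.

Definition bic_scale (a : R) w := Bicomplex (a *: re_j w) (a *: im_j w).

Lemma bic_scaleA a b w : bic_scale a (bic_scale b w) = bic_scale (a * b) w.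
Proof. by rewrite /bic_scale /= !scalerA. Qed.
Lemma bic_scale1 : left_id 1 bic_scale.
Proof. by move=> [a b]; rewrite /bic_scale /= !scale1r. Qed.
Lemma bic_scaleDr : right_distributive bic_scale +%R.
Proof. by move=> a w1 w2; rewrite /bic_scale /= !scalerDr. Qed.
Lemma bic_scaleDl w : {morph bic_scale^~ w : a b / a + b}.
Proof. by move=> a b; rewrite /bic_scale /= !scalerDl. Qed.
HB.instance Definition _ := GRing.Zmodule_isLmodule.Build R (bicomplex R)
  bic_scaleA bic_scale1 bic_scaleDr bic_scaleDl.

Lemma bic_scaleAl (a : R) w1 w2 : a *: (w1 * w2) = (a *: w1) * w2.
Proof.
case: w1 w2 => [b c] [d e]; congr Bicomplex => /=.
  by rewrite scalerBr !scalerAl.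
by rewrite scalerDr !scalerAl.
Qed.
HB.instance Definition _ :=
  GRing.Lmodule_isLalgebra.Build R (bicomplex R) bic_scaleAl.
HB.instance Definition _ := GRing.Lalgebra_isComAlgebra.Build R (bicomplex R).

End BicomplexAlgebra.

(* The inclusion of the hyperbolic numbers in the bicomplex numbers. *)
Definition hyp_bic (R : realType) (z : hyperbolic R) : bicomplex R :=
  Bicomplex z 0.

Notation "z %:B" := (hyp_bic z) (at level 1, format "z %:B") : ring_scope.

Section Bicomplex.
Variable R : realType.
Implicit Types w : bicomplex R.

Definition bi : bicomplex R := Bicomplex 0 1.
Definition bj : bicomplex R := (hj R)%:B.
(* i k = j and i ^ 2 = -1 force k = - i j. *)
Definition bk : bicomplex R := - (bi * bj).

Definition bic_abs_j w : hyperbolic R := hsqrt (re_j w ^+ 2 + im_j w ^+ 2).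

Lemma bic_reim w : w = (re_j w)%:B + bi * (im_j w)%:B.
Proof.
by case: w => a b; congr Bicomplex => /=;
  rewrite !(mul0r, mulr0, mul1r, addr0, add0r, subr0, oppr0).
Qed.

Lemma bic_table :
  [/\ bi * bi = -1, bk * bk = -1, bj * bj = 1, bi * bk = bj & bk * bi = bj].
Proof.
have ii : bi * bi = -1 by congr Bicomplex => /=; ring.
have jj : bj * bj = 1.
  by congr Bicomplex => /=; rewrite -?hjj; ring.
split=> //; rewrite /bk.
- by rewrite mulrNN mulrACA ii jj mulr1.
- by rewrite mulrN mulrA ii mulN1r opprK.
- by rewrite mulrC mulrN mulrA ii mulN1r opprK.
Qed.

Lemma bic_abcd (a b c d : R) :
  a *: 1 + b *: bi + c *: bj + d *: bk
  = Bicomplex (Hyperbolic a c) (Hyperbolic b (- d)).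
Proof.
congr Bicomplex; congr Hyperbolic => /=; ring.
Qed.

End Bicomplex.

(* Main.v *)
Require Import Defs.
From mathcomp Require Import all_boot all_order all_algebra.
From mathcomp Require Import ring.
From mathcomp Require Import all_classical all_reals all_analysis.

Import Order.TTheory GRing.Theory Num.Theory.

Local Open Scope ring_scope.

(** In the idempotent basis e1, e2 the hyperbolic numbers are R x R with
    componentwise operations, and cos, sin and the square root also act
    componentwise, so the claim is the polar form of a point of the real plane
    in each component; a zero divisor has a zero component, where any angle
    works. *)

(** The angle is [acos c] up to sign: its sine is [sqrt (1 - c^2)], that is [|s|], so the sign of
    [s] decides between [acos c] and its opposite. *)
Lemma unit_circle_angle {R : realType} (c s : R) : c ^+ 2 + s ^+ 2 = 1 ->
  exists t : R, c = cos t /\ s = sin t.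
Proof.
move=> cs1.
have c11 : -1 <= c <= 1.
  by rewrite -ler_norml -(@expr_le1 _ 2) // real_normK ?num_real // -cs1 lerDl sqr_ge0.
have sE : sin (acos c) = `|s|.
  by rewrite sin_acos // -cs1 addrC addKr sqrtr_sqr.
have [s0|s0] := leP 0 s.
  by exists (acos c); rewrite acosK // sE ger0_norm.
by exists (- acos c); rewrite cosN sinN acosK // sE ltr0_norm // opprK.
Qed.

Lemma polar_form {R : realType} (x y : R) : exists t : R,
  x = Num.sqrt (x ^+ 2 + y ^+ 2) * cos t /\
  y = Num.sqrt (x ^+ 2 + y ^+ 2) * sin t.
Proof.
set r := Num.sqrt _.
have r2 : r ^+ 2 = x ^+ 2 + y ^+ 2 by rewrite sqr_sqrtr // addr_ge0 ?sqr_ge0.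
have [r0|r0] := eqVneq r 0.
  (* A vanishing sum of two real squares forces [x = y = 0]; the angle 0 is an arbitrary choice. *)
  exists 0; rewrite r0 !mul0r; move/esym/eqP: r2.
  by rewrite r0 expr0n paddr_eq0 ?sqr_ge0 // !sqrf_eq0 => /andP[/eqP-> /eqP->].
have [|t [ct st]] := @unit_circle_angle R (x / r) (y / r).
  by rewrite !expr_div_n -mulrDl -r2 divff // sqrf_eq0.
by exists t; rewrite -ct -st ![r * _]mulrC !divfK.
Qed.

Lemma hpi_inj {R : realType} (z w : hyperbolic R) :
  hpi1 z = hpi1 w -> hpi2 z = hpi2 w -> z = w.
Proof. by move=> h1 h2; rewrite (hyp_idem z) h1 h2 -hyp_idem. Qed.

Lemma hpi1_idem {R : realType} (a b : R) : hpi1 (a *: he1 R + b *: he2 R) = a.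
Proof. by rewrite /hpi1 /=; field. Qed.

Lemma hpi2_idem {R : realType} (a b : R) : hpi2 (a *: he1 R + b *: he2 R) = b.
Proof. by rewrite /hpi2 /=; field. Qed.

(** Splits the polar equation into one hyperbolic equation for each of [re_j] and [im_j]. *)
Lemma hyp_bic_mul {R : realType} (r c s : hyperbolic R) :
  r%:B * (c%:B + bi R * s%:B) = Bicomplex (r * c) (r * s).
Proof. by congr Bicomplex => /=; ring. Qed.

Theorem proposition4p1 (R : realType) (omega : bicomplex R) (homega : omega != 0) :
  exists phi : hyperbolic R,
    omega = (bic_abs_j omega)%:B * ((hcos phi)%:B + bi R * (hsin phi)%:B).
Proof.
case: omega {homega} => z w; rewrite /bic_abs_j /=.
have [t [zt wt]] := polar_form (hpi1 z) (hpi1 w).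
have [u [zu wu]] := polar_form (hpi2 z) (hpi2 w).
(* The components of [phi] are the angles of the plane points [(hpi1 z, hpi1 w)] and
   [(hpi2 z, hpi2 w)]. *)
exists (t *: he1 R + u *: he2 R).
rewrite hyp_bic_mul; congr Bicomplex; apply: hpi_inj.
(* The four remaining real equations reduce to [zt], [zu], [wt] and [wu]. *)
all: rewrite ?hpi1M ?hpi2M ?hcosE ?hsinE /hsqrt ?hpi1_idem ?hpi2_idem.
all: by rewrite ?hpi1D ?hpi2D ?hpi1X ?hpi2X.
Qed.
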